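(* Let $(A,\circ,\lhd,\rhd)$ be a post-Novikov algebra and let $(A,\circledcirc)$ be its associated Novikov algebra, $a\circledcirc b:=a\rhd b+a\lhd b+a\circ b$ for $a,b\in A$. Define linear maps $L_\rhd,R_\lhd:A\to \mathrm{End}_{\mathbf k}(A)$ by $L_\rhd(a)b:=a\rhd b$ and $R_\lhd(b)a:=a\lhd b$ for all $a,b\in A$. Then $(A,\circ,L_\rhd,R_\lhd)$ is an $(A,\circledcirc)$-bimodule Novikov algebra.
   Context: $\mathbf k$ is a field of characteristic zero; all vector spaces are finite-dimensional over $\mathbf k$. A Novikov algebra $(A,\circ)$ is a vector space with a bilinear operation satisfying $(a\circ b)\circ c-a\circ(b\circ c)=(b\circ a)\circ c-b\circ(a\circ c)$ and $(a\circ b)\circ c=(a\circ c)\circ b$ for all $a,b,c\in A$. A bimodule of a Novikov algebra $(A,\circ)$ is a triple $(V,l_A,r_A)$ with $V$ a vector space and $l_A,r_A:A\to\mathrm{End}_{\mathbf k}(V)$ linear such that for all $a,b\in A$, $v\in V$: $l_A(a\circ b-b\circ a)v=l_A(a)l_A(b)v-l_A(b)l_A(a)v$; $l_A(a)r_A(b)v-r_A(b)l_A(a)v=r_A(a\circ b)v-r_A(b)r_A(a)v$; $l_A(a\circ b)v=r_A(b)l_A(a)v$; $r_A(a)r_A(b)v=r_A(b)r_A(a)v$. An $A$-bimodule Novikov algebra is a quadruple $(M,\cdot,l_A,r_A)$ where $(M,\cdot)$ is a Novikov algebra, $(M,l_A,r_A)$ is a bimodule of $(A,\circ)$, and for all $a\in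 A$, $v,w\in M$: $(l_A(a)v)\cdot w-l_A(a)(v\cdot w)=(r_A(a)v)\cdot w-v\cdot(l_A(a)w)$; $r_A(a)(v\cdot w)-v\cdot(r_A(a)w)=r_A(a)(w\cdot v)-w\cdot(r_A(a)v)$; $(l_A(a)v)\cdot w=(l_A(a)w)\cdot v$; $r_A(a)(v\cdot w)=(r_A(a)v)\cdot w$. A post-Novikov algebra is a quadruple $(A,\circ,\lhd,\rhd)$ where $(A,\circ)$ is a Novikov algebra and $\lhd,\rhd$ are bilinear operations such that for all $a,b,c\in A$: (1) $(a\rhd c)\lhd b=(a\rhd b+a\lhd b+a\circ b)\rhd c$; (2) $a\rhd(c\lhd b)-(a\rhd c)\lhd b+(c\lhd a)\lhd b=c\lhd(a\lhd b+a\rhd b+a\circ b)$; (3) $(a\rhd b+a\lhd b+a\circ b)\rhd c-(b\rhd a+b\lhd a+b\circ a)\rhd c=a\rhd(b\rhd c)-b\rhd(a\rhd c)$; (4) $(a\lhd b)\lhd c=(a\lhd c)\lhd b$; (5) $(a\rhd b)\circ c-a\rhd(b\circ c)=(b\lhd a)\circ c-b\circ(a\rhd c)$; (6) $(b\circ c)\lhd a-b\circ(c\lhd a)=(c\circ b)\lhd a-c\circ(b\lhd a)$; (7) $(a\rhd b)\circ c=(a\rhd c)\circ b$; (8) $(a\circ b)\lhd c=(a\lhd c)\circ b$. For any post-Novikov algebra, $(A,\circledcirc)$ as defined in the claim is a Novikov algebra. *)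

(* Defs.v *)
From HB Require Import structures.
From mathcomp Require Import all_boot all_order all_algebra.

Set Implicit Arguments.
Unset Strict Implicit.
Unset Printing Implicit Defensive.

Import GRing.Theory.

Local Open Scope ring_scope.

Record novikov (K : fieldType) (A : vectType K)
    (mu : {bilinear A -> A -> A}) : Prop := Novikov {
  novikov_left_symmetric : forall a b c,
    mu (mu a b) c - mu a (mu b c) = mu (mu b a) c - mu b (mu a c);
  novikov_right_commutative : forall a b c,
    mu (mu a b) c = mu (mu a c) b
}.

(* The first field records that [(A, mu)] is a Novikov algebra: only over such
   an algebra is the notion of a bimodule defined. *)
Record novikov_bimodule (K : fieldType) (A V : vectType K)
    (mu : {bilinear A -> A -> A}) (l r : 'Hom(A, 'End(V))) : Prop :=
    NovikovBimodule {
  bimodule_base : novikov mu;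
  bimodule_left : forall a b v,
    l (mu a b - mu b a) v = l a (l b v) - l b (l a v);
  bimodule_left_right : forall a b v,
    l a (r b v) - r b (l a v) = r (mu a b) v - r b (r a v);
  bimodule_left_mul : forall a b v,
    l (mu a b) v = r b (l a v);
  bimodule_right_comm : forall a b v,
    r a (r b v) = r b (r a v)
}.

(* [(M, nu, l, r)] is an [(A, mu)]-bimodule Novikov algebra. *)
Record bimodule_novikov_algebra (K : fieldType) (A M : vectType K)
    (mu : {bilinear A -> A -> A}) (nu : {bilinear M -> M -> M})
    (l r : 'Hom(A, 'End(M))) : Prop := BimoduleNovikovAlgebra {
  bimodule_novikov_algebra_novikov : novikov nu;
  bimodule_novikov_algebra_bimodule : novikov_bimodule mu l r;
  bimodule_novikov_algebra_left : forall a v w,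
    nu (l a v) w - l a (nu v w) = nu (r a v) w - nu v (l a w);
  bimodule_novikov_algebra_right : forall a v w,
    r a (nu v w) - nu v (r a w) = r a (nu w v) - nu w (r a v);
  bimodule_novikov_algebra_left_comm : forall a v w,
    nu (l a v) w = nu (l a w) v;
  bimodule_novikov_algebra_right_mul : forall a v w,
    r a (nu v w) = nu (r a v) w
}.

Section PostNovikov.
Variables (K : fieldType) (A : vectType K).
Variables circ lhd rhd : {bilinear A -> A -> A}.

Local Notation "a ∘ b" := (circ a b) (at level 40, left associativity).
Local Notation "a ⊲ b" := (lhd a b) (at level 40, left associativity).
Local Notation "a ⊳ b" := (rhd a b) (at level 40, left associativity).

Record post_novikov : Prop := PostNovikov {
  post_novikov_base : novikov circ;
  post_novikov1 : forall a b c,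
    (a ⊳ c) ⊲ b = (a ⊳ b + a ⊲ b + a ∘ b) ⊳ c;
  post_novikov2 : forall a b c,
    a ⊳ (c ⊲ b) - (a ⊳ c) ⊲ b + (c ⊲ a) ⊲ b
    = c ⊲ (a ⊲ b + a ⊳ b + a ∘ b);
  post_novikov3 : forall a b c,
    (a ⊳ b + a ⊲ b + a ∘ b) ⊳ c - (b ⊳ a + b ⊲ a + b ∘ a) ⊳ c
    = a ⊳ (b ⊳ c) - b ⊳ (a ⊳ c);
  post_novikov4 : forall a b c,
    (a ⊲ b) ⊲ c = (a ⊲ c) ⊲ b;
  post_novikov5 : forall a b c,
    (a ⊳ b) ∘ c - a ⊳ (b ∘ c) = (b ⊲ a) ∘ c - b ∘ (a ⊳ c);
  post_novikov6 : forall a b c,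
    (b ∘ c) ⊲ a - b ∘ (c ⊲ a) = (c ∘ b) ⊲ a - c ∘ (b ⊲ a);
  post_novikov7 : forall a b c,
    (a ⊳ b) ∘ c = (a ⊳ c) ∘ b;
  post_novikov8 : forall a b c,
    (a ∘ b) ⊲ c = (a ⊲ c) ∘ b
}.

Definition assoc_op (a b : A) : A := a ⊳ b + a ⊲ b + a ∘ b.

Fact assoc_op_bilinear : bilinear_for *:%R *:%R assoc_op.
Proof.
split=> u k x y; rewrite /assoc_op /= ?linearPl ?linearPr !scalerDr /=.
  by rewrite (addrACA (k *: (x ⊳ u))) (addrACA (k *: (x ⊳ u) + _)).
by rewrite (addrACA (k *: (u ⊳ x))) (addrACA (k *: (u ⊳ x) + _)).
Qed.

HB.instance Definition _ :=
  bilinear_isBilinear.Build K A A A *:%R *:%R assoc_op assoc_op_bilinear.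

End PostNovikov.

Section Multiplications.
Variables (K : fieldType) (A : vectType K) (mu : {bilinear A -> A -> A}).

(* [linfun f] is only meaningful when [f] is linear; [left_mulE] and
   [right_mulE] discharge this for both layers of each definition. *)
Definition left_mul : 'Hom(A, 'End(A)) :=
  linfun (fun a => linfun (fun b => mu a b)).

Definition right_mul : 'Hom(A, 'End(A)) :=
  linfun (fun b => linfun (fun a => mu a b)).

Lemma left_mulE a b : left_mul a b = mu a b.
Proof.
have lin : linear (fun a' : A => linfun (fun b' => mu a' b')).
  move=> k x y; apply/lfunP=> v.
  by rewrite add_lfunE scale_lfunE (lfunE (mu (k *: x + y))) (lfunE (mu x))
    (lfunE (mu y)) /= linearPl.
pose f : {linear A -> 'End(A)} :=
  HB.pack (fun a' : A => linfun (fun b' => mu a' b'))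
    (GRing.isLinear.Build K A 'End(A) *:%R _ lin).
by rewrite /left_mul (lfunE f) (lfunE (mu a)).
Qed.

Lemma right_mulE a b : right_mul b a = mu a b.
Proof.
have lin : linear (fun b' : A => linfun (fun a' => mu a' b')).
  move=> k x y; apply/lfunP=> v.
  by rewrite add_lfunE scale_lfunE (lfunE (applyr mu (k *: x + y)))
    (lfunE (applyr mu x)) (lfunE (applyr mu y)) /= linearPr.
pose f : {linear A -> 'End(A)} :=
  HB.pack (fun b' : A => linfun (fun a' => mu a' b'))
    (GRing.isLinear.Build K A 'End(A) *:%R _ lin).
by rewrite /right_mul (lfunE f) (lfunE (applyr mu b)).
Qed.

End Multiplications.

(* Main.v *)
Require Import Defs.
From mathcomp Require Import all_boot all_order all_algebra.

Import GRing.Theory.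

Local Open Scope ring_scope.

(** The eight post-Novikov axioms are the bimodule and compatibility conditions for [circ], read
    through left multiplication by [rhd] and right multiplication by [lhd]. The substance is
    [assoc_op_novikov], demanded by [bimodule_base]: expanding both Novikov identities of the sum
    operation splits them into groups of terms, each with the required symmetry by one axiom or by a
    law of [circ]. *)

Lemma subr_exchange {V : zmodType} {x y u v : V} :
  x - y = u - v -> x - u = y - v.
Proof.
by move/eqP; rewrite subr_eq addrAC => /eqP ->;
  rewrite [LHS](ACl (1*4*2*3)) /= subrr add0r.
Qed.

Lemma assoc_op_novikov {K : fieldType} {A : vectType K}
    {circ lhd rhd : {bilinear A -> A -> A}}
    (postA : post_novikov circ lhd rhd) :
  novikov (assoc_op circ lhd rhd).
Proof.
case: postA => -[circ_ls circ_rc] p1 p2 p3 p4 p5 p6 p7 p8.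
pose m := assoc_op circ lhd rhd.
have mE a b : m a b = rhd a b + lhd a b + circ a b by [].
have right_comm x y z : m (m x y) z = m (m x z) y.
  (* [p1] trades the term acting through [m x b] for a [lhd] product, so that each group is
     invariant under swapping [b] and [c]; in the mixed pair, [p8] shows that the swap exchanges the
     two terms. *)
  have mmE b c : m (m x b) c =
      (lhd (rhd x c) b + lhd (rhd x b) c) + lhd (lhd x b) c
      + (lhd (circ x b) c + circ (lhd x b) c)
      + circ (rhd x b) c + circ (circ x b) c.
    by rewrite mE {1}mE -p1 mE !linearDl /= !addrA [LHS](ACl (1*2*3*4*6*5*7)).
  rewrite !mmE (addrC (lhd (rhd x z) y)) (p4 x y) (p7 x y) (circ_rc x y).
  by rewrite !p8 (addrC (circ (lhd x z) y)).
(* Each bracket is symmetric in [x] and [y]: by axioms (3), (2), (5), (6) and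
   the left symmetry of [circ], in this order. *)
have associatorE x y z : m (m x y) z - m x (m y z) =
    (rhd (m x y) z - rhd x (rhd y z))
    + (lhd (rhd x y) z + lhd (lhd x y) z - rhd x (lhd y z) - lhd x (m y z))
    + (circ (rhd x y) z + circ (lhd x y) z - rhd x (circ y z)
       - circ x (rhd y z))
    + (lhd (circ x y) z - circ x (lhd y z))
    + (circ (circ x y) z - circ x (circ y z)).
  rewrite !mE !linearDl !linearDr /= !opprD !addrA.
  by rewrite [LHS](ACl (1*2*3*10*4*5*11*13*14*15*7*8*12*16*6*17*9*18)).
have sym3 x y z : rhd (m x y) z - rhd x (rhd y z) =
    rhd (m y x) z - rhd y (rhd x z) := subr_exchange (p3 x y z).
(* Expanding [lhd x (m y z)] by [p2] cancels [lhd (lhd x y) z] and leaves a difference of two sums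
   visibly symmetric in [x] and [y]. *)
have sym2 x y z :
    lhd (rhd x y) z + lhd (lhd x y) z - rhd x (lhd y z) - lhd x (m y z) =
    lhd (rhd x y) z + lhd (rhd y x) z - (rhd x (lhd y z) + rhd y (lhd x z)).
  rewrite mE (addrC (rhd y z)) -p2 !opprD opprK !addrA.
  by rewrite [LHS](ACl (2*6*1*5*3*4)) /= subrr add0r.
(* Here [p5] supplies the mirror images of the two terms it leaves alone. *)
have sym5 x y z :
    circ (rhd x y) z + circ (lhd x y) z - rhd x (circ y z)
      - circ x (rhd y z) =
    circ (lhd y x) z + circ (lhd x y) z
      - (circ y (rhd x z) + circ x (rhd y z)).
  by rewrite (addrAC (circ (rhd x y) z)) p5 opprD addrA (addrAC _ (- circ y _)).
have left_symm x y z : m (m x y) z - m x (m y z) = m (m y x) z - m y (m x z).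
  rewrite !associatorE sym3 !sym2 !sym5 p6 circ_ls.
  rewrite (addrC (lhd (rhd x y) z)) (addrC (rhd x (lhd y z))).
  by rewrite (addrC (circ (lhd y x) z)) (addrC (circ y (rhd x z))).
by split=> x y z; [exact: left_symm | exact: right_comm].
Qed.

Theorem lemma2p15 (K : fieldType) (charK0 : [pchar K] =i pred0)
    (A : vectType K) (circ lhd rhd : {bilinear A -> A -> A})
    (postA : post_novikov circ lhd rhd) :
  bimodule_novikov_algebra (assoc_op circ lhd rhd) circ
    (left_mul rhd) (right_mul lhd).
Proof.
have novA := assoc_op_novikov postA.
case: postA => nov p1 p2 p3 p4 p5 p6 p7 p8.
(* Only the conditions coming from [p3] and [p2] survive, as they differ from these axioms by
   linearity or by rearranging terms. *)
split=> //; first split=> //; move=> a v w; rewrite ?left_mulE ?right_mulE //.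
- by rewrite linearBl /= -p3.
- by rewrite /= /assoc_op (addrC (rhd a v)) -p2 addrK.
Qed.
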